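(* Let $\mathscr{F}\subseteq\mathscr{P}(\omega)$ be an $\omega$-closed family. Then $\boldsymbol{B}_{\mathbb{Z}}^{\mathscr{F}}$ is an inverse semigroup.
   Context: $\omega$ is the set of non-negative integers and $\mathscr{P}(\omega)$ is the family of all its subsets. For $n\in\mathbb{Z}$ and $A\subseteq\mathbb{Z}$ put $n+A=\{n+a: a\in A\}$ (so $n+\varnothing=\varnothing$). A family $\mathscr{F}\subseteq\mathscr{P}(\omega)$ is $\omega$-closed if $F_1\cap(-n+F_2)\in\mathscr{F}$ for all $n\in\omega$ and $F_1,F_2\in\mathscr{F}$. For an $\omega$-closed family $\mathscr{F}$, the set $\mathbb{Z}\times\mathbb{Z}\times\mathscr{F}$ carries the associative operation $$(i_1,j_1,F_1)\cdot(i_2,j_2,F_2)=\begin{cases}(i_1-j_1+i_2,\;j_2,\;(j_1-i_2+F_1)\cap F_2), & j_1<i_2;\\ (i_1,\;j_2,\;F_1\cap F_2), & j_1=i_2;\\ (i_1,\;j_1-i_2+j_2,\;F_1\cap(i_2-j_1+F_2)), & j_1>i_2.\end{cases}$$ If $\varnothing\in\mathscr{F}$, then $\boldsymbol{I}=\{(i,j,\varnothing): i,j\in\mathbb{Z}\}$ is an ideal and $\boldsymbol{B}_{\mathbb{Z}}^{\mathscr{F}}$ is defined as the Rees quotient $(\mathbb{Z}\times\mathbb{Z}\times\mathscr{F},\cdot)/\boldsymbol{I}$ ($\boldsymbol{I}$ is collapsed to one element, the zero); if $\varnothing\notin\mathscr{F}$, then $\boldsymbol{B}_{\mathbb{Z}}^{\mathscr{F}}=(\mathbb{Z}\times\mathbb{Z}\times\mathscr{F},\cdot)$.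 A semigroup $S$ is inverse if for each $x\in S$ there is a unique $x^{-1}\in S$ with $xx^{-1}x=x$ and $x^{-1}xx^{-1}=x^{-1}$. *)

(* Defs.v *)
From HB Require Import structures.
From mathcomp Require Import all_boot all_order all_algebra.
From mathcomp Require Import boolp classical_sets.
From mathcomp Require Import zify.

Set Implicit Arguments.
Unset Strict Implicit.
Unset Printing Implicit Defensive.

Import Order.TTheory GRing.Theory Num.Theory.
Local Open Scope ring_scope.
Local Open Scope classical_set_scope.
Local Open Scope quotient_scope.

Definition inverse_semigroup (S : semigroupType) : Prop :=
  forall x : S, exists! y : S, (x * y * x = x /\ y * x * y = y)%g.

Section ReesQuotient.
Variable S : semigroupType.

Definition ideal (I : set S) : Prop :=
  I !=set0 /\ forall x y : S, I x -> I (x * y)%g /\ I (y * x)%g.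

Variables (I : set S) (idI : ideal I).

Definition rees_rel : rel S := fun x y => (x == y) || `[< I x /\ I y >].

Lemma rees_relP x y : reflect (x = y \/ I x /\ I y) (rees_rel x y).
Proof.
apply: (iffP orP) => -[/eqP|H]; [by left | | by left |].
- by right; apply/asboolP.
- by right; apply/asboolP.
Qed.

Lemma rees_rel_refl : reflexive rees_rel.
Proof. by move=> x; rewrite /rees_rel eqxx. Qed.

Lemma rees_rel_sym : symmetric rees_rel.
Proof.
by move=> x y; apply/rees_relP/rees_relP => -[->|[? ?]]; by [left | right].
Qed.

Lemma rees_rel_trans : transitive rees_rel.
Proof.
move=> y x z /rees_relP[->//|[Ix Iy]] /rees_relP[<-|[_ Iz]].
- by apply/rees_relP; right.
- by apply/rees_relP; right.
Qed.

Definition rees_equiv : equiv_rel S :=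
  EquivRel rees_rel rees_rel_refl rees_rel_sym rees_rel_trans.

(* The parameter [idI] keeps the quotient tied to the proof that its product
   is well defined. *)
Definition rees_quotient of ideal I : Type := {eq_quot rees_equiv}.

Local Notation Q := (rees_quotient idI).

HB.instance Definition _ := Choice.copy Q {eq_quot rees_equiv}.
HB.instance Definition _ := EqQuotient.copy Q {eq_quot rees_equiv}.

Definition rees_mul : Q -> Q -> Q :=
  fun a b => \pi_Q (repr a * repr b)%g.

Lemma rees_mulE (x y : S) : rees_mul (\pi_Q x) (\pi_Q y) = \pi_Q (x * y)%g.
Proof.
have congr z : rees_rel (repr (\pi_Q z)) z.
  by have /eqmodP := reprK (\pi_Q z).
have [_ idlr] := idI.
apply/eqmodP/rees_relP.
case/rees_relP: (congr x) => [->|[Irx Ix]].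
- case/rees_relP: (congr y) => [->|[Iry Iy]]; first by left.
  by right; split; [exact: (idlr _ x Iry).2 | exact: (idlr _ x Iy).2].
- by right; split; [exact: (idlr _ _ Irx).1 | exact: (idlr _ _ Ix).1].
Qed.

Lemma rees_mulA : associative rees_mul.
Proof.
move=> x y z; rewrite -(reprK x) -(reprK y) -(reprK z).
move: (repr x) (repr y) (repr z) => a b c.
by rewrite (rees_mulE a b) (rees_mulE b c) (rees_mulE a) (rees_mulE _ c) mulgA.
Qed.

HB.instance Definition _ := isSemigroup.Build Q rees_mulA.

End ReesQuotient.

(* Both omega and Z-translates of its subsets live in [set int]. *)
Definition omega : set int := [set n | 0 <= n].

Definition shift (n : int) (A : set int) : set int := [set n + a | a in A].

Definition omega_closed (F : set (set int)) : Prop :=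
  forall n : int, omega n -> forall F1 F2 : set int,
    F F1 -> F F2 -> F (F1 `&` shift (- n) F2).

Definition triple_mul (x y : int * int * set int) : int * int * set int :=
  let: (i1, j1, F1) := x in
  let: (i2, j2, F2) := y in
  if j1 < i2 then (i1 - j1 + i2, j2, shift (j1 - i2) F1 `&` F2)
  else if j1 == i2 then (i1, j2, F1 `&` F2)
  else (i1, j1 - i2 + j2, F1 `&` shift (i2 - j1) F2).

Lemma shiftE n A x : shift n A x = A (x - n).
Proof.
apply/propext; split=> [[a Aa <-]|Ax]; first by rewrite addrC addKr.
by exists (x - n) => //; rewrite addrC subrK.
Qed.

Lemma shift0 A : shift 0 A = A.
Proof. by apply/funext => x; rewrite shiftE subr0. Qed.

Lemma shiftI n A B : shift n (A `&` B) = shift n A `&` shift n B.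
Proof. by apply/funext => x; rewrite /setI /mkset !shiftE. Qed.

Lemma shift_shift m n A : shift m (shift n A) = shift (m + n) A.
Proof. by apply/funext => x; rewrite !shiftE opprD addrA. Qed.

Lemma triple_mulE x y : triple_mul x y =
  let m := Num.max x.1.2 y.1.1 in
  (x.1.1 - x.1.2 + m, y.1.2 - y.1.1 + m,
   shift (x.1.2 - m) x.2 `&` shift (y.1.1 - m) y.2).
Proof.
case: x y => [[i1 j1] F1] [[i2 j2] F2] /=.
case: ltgtP => [lt|gt|<-]; rewrite !subrr !shift0 ?subrK //.
by congr (_, _, _); lia.
Qed.

Lemma triple_mulA : associative triple_mul.
Proof.
move=> [[i1 j1] F1] [[i2 j2] F2] [[i3 j3] F3]; rewrite !triple_mulE /=.
rewrite !shiftI !shift_shift setIA.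
by congr (_, _, shift _ _ `&` shift _ _ `&` shift _ _); lia.
Qed.

Section Extension.
Variables (F : set (set int)) (clF : omega_closed F).

Lemma triple_mul_closed (x y : int * int * set int) :
  F x.2 -> F y.2 -> F (triple_mul x y).2.
Proof.
case: x y => [[i1 j1] F1] [[i2 j2] F2] /= FF1 FF2.
case: ltgtP => [lt|gt|_] /=.
- rewrite setIC -[j1 - i2]opprB; apply: clF => //.
  by rewrite /omega /= subr_ge0 ltW.
- rewrite -[i2 - j1]opprB; apply: clF => //.
  by rewrite /omega /= subr_ge0 ltW.
- by rewrite -[F2]shift0 -oppr0; apply: clF => //; rewrite /omega /=.
Qed.

(* The parameter [clF] is what makes the product below internal. *)
Definition ZZF of omega_closed F : Type := (int * int * F)%type.

Local Notation B := (ZZF clF).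

HB.instance Definition _ := Choice.copy B (int * int * F)%type.

Definition triple (x : B) : int * int * set int := (x.1, val x.2).

Lemma triple_inj : injective triple.
Proof. by move=> [p A] [q C] [-> /val_inj ->]. Qed.

Lemma ZZF_mul_subproof (x y : B) : (triple_mul (triple x) (triple y)).2 \in F.
Proof.
by apply/mem_set/triple_mul_closed; apply: set_mem; apply: (valP _.2).
Qed.

Definition ZZF_mul (x y : B) : B :=
  ((triple_mul (triple x) (triple y)).1, SigSub (ZZF_mul_subproof x y)).

Lemma triple_ZZF_mul x y :
  triple (ZZF_mul x y) = triple_mul (triple x) (triple y).
Proof. by rewrite [RHS]surjective_pairing. Qed.

Lemma ZZF_mulA : associative ZZF_mul.
Proof.
by move=> x y z; apply: triple_inj; rewrite !triple_ZZF_mul triple_mulA.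
Qed.

HB.instance Definition _ := isSemigroup.Build B ZZF_mulA.

Definition empty_ideal : set B := [set x | val x.2 = set0].

Lemma empty_ideal_ideal : F set0 -> ideal empty_ideal.
Proof.
have shift_set0 n : shift n set0 = set0 by rewrite /shift image_set0.
move=> F0; split; first by exists ((0, 0), SigSub (mem_set F0)).
move=> x y Ix; split.
- change ((triple_mul (triple x) (triple y)).2 = set0).
  by rewrite triple_mulE /= Ix shift_set0 set0I.
- change ((triple_mul (triple y) (triple x)).2 = set0).
  by rewrite triple_mulE /= Ix shift_set0 setI0.
Qed.

Definition BZF : semigroupType :=
  match pselect (F set0) with
  | left F0 => rees_quotient (empty_ideal_ideal F0)
  | right _ => B
  end.

End Extension.

(* Main.v *)
Require Import Defs.
From mathcomp Require Import all_boot all_order all_algebra.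
From mathcomp Require Import boolp classical_sets.
From mathcomp Require Import zify.

Import Order.TTheory.

Local Open Scope classical_set_scope.

(** On the index pairs the product is that of the extended bicyclic semigroup,
    where the inverse of [(i, j)] is [(j, i)]; once the indices are fixed, the
    set components of mutually inverse triples include each other. Hence the
    triples form an inverse semigroup even when the empty set belongs to the
    family, and a Rees quotient of an inverse semigroup is inverse because an
    inverse of a class outside the ideal is represented outside the ideal. *)

Lemma rees_quotient_inverse (S : semigroupType) (I : set S) (idI : ideal I) :
  inverse_semigroup S -> inverse_semigroup (rees_quotient idI : semigroupType).
Proof.
move=> invS u.
have [_ idlr] := idI.
pose Q : semigroupType := rees_quotient idI.
(* [p] is kept opaque, as otherwise [rewrite pM] unfolds the product. *)
have [p [pE pM p_surj]] : exists p : S -> Q,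
    [/\ forall a b, p a = p b <-> a = b \/ I a /\ I b,
        forall a b, (p a * p b)%g = p (a * b)%g &
        forall v, exists a, v = p a].
  exists (fun a => \pi_(rees_quotient idI) a)%qT; split=> [a b|a b|v].
  - by split=> [/eqmodP/rees_relP|ab]; last by apply/eqmodP/rees_relP.
  - exact: rees_mulE.
  - by exists (repr (v : rees_quotient idI)); rewrite reprK.
have [x ->] := p_surj u.
have [y [[xyx yxy] uniq_y]] := invS x.
exists (p y); split; first by rewrite !pM xyx yxy.
move=> v; have [z ->] := p_surj v; rewrite !pM => -[/pE xzx /pE zxz].
have I_sandwich a b : I a -> I (b * a * b)%g.
  by move=> /(idlr _ b)[_ /(idlr _ b)[]].
case: (pselect (I x)) => [Ix|nIx].
  (* With [x] in [I], the relations [yxy = y] and [zxz = z] put [y] and [z] in [I], so both classes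
     are the zero. *)
  apply/pE; right; split; first by rewrite -yxy; apply: I_sandwich.
  by case: zxz => [<-|[]//]; apply: I_sandwich.
(* Off [I], the relation [xzx = x] holds in [S] itself and keeps [z] out of [I], so [zxz = z] lifts
   to [S] as well. *)
apply/pE; left; apply: uniq_y.
case: xzx => [xzx|[_ /nIx//]]; split=> //.
case: zxz => // -[_ Iz]; case: nIx; rewrite -xzx; exact: I_sandwich.
Qed.

Lemma triple_mul_inv (i j : int) (A : set int) :
  triple_mul (triple_mul (i, j, A) (j, i, A)) (i, j, A) = (i, j, A).
Proof. by rewrite /= ltxx eqxx /= ltxx eqxx !setIid. Qed.

Lemma triple_mul_inv_unique (i j k l : int) (A C : set int) :
  triple_mul (triple_mul (i, j, A) (k, l, C)) (i, j, A) = (i, j, A) ->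
  triple_mul (triple_mul (k, l, C) (i, j, A)) (k, l, C) = (k, l, C) ->
  (j, i, A) = (k, l, C).
Proof.
move=> xyx yxy.
have [jk il] : j = k /\ i = l.
  (* The indices of [xyx] give [l <= i] and [k - l = j - i]; those of [yxy] give [i <= l]. *)
  by move: xyx yxy; rewrite !triple_mulE /= => -[? ? _] [? ? _]; lia.
move: xyx yxy; rewrite -jk -il /= !ltxx !eqxx /= !ltxx !eqxx => -[AC] [CA].
rewrite setIAC setIid in AC; rewrite setIAC setIid in CA.
by congr (_, _); rewrite -CA setIC AC.
Qed.

Lemma ZZF_inverse (F : set (set int)) (clF : omega_closed F) :
  inverse_semigroup (ZZF clF : semigroupType).
Proof.
move=> [[i j] A]; exists ((j, i), A); split.
  by split; apply: triple_inj; rewrite !triple_ZZF_mul; apply: triple_mul_inv.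
move=> [[k l] C] [/(congr1 (@triple _ _)) xyx /(congr1 (@triple _ _)) yxy].
move: xyx yxy; rewrite !triple_ZZF_mul => xyx yxy.
apply: triple_inj; exact: triple_mul_inv_unique xyx yxy.
Qed.

Theorem mainTheorem1 (F : set (set int))
    (subF : F `<=` [set A | A `<=` omega]) (clF : omega_closed F) :
  inverse_semigroup (BZF clF).
Proof.
rewrite /BZF; case: pselect => [F0|_]; last exact: ZZF_inverse.
exact/rees_quotient_inverse/ZZF_inverse.
Qed.
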